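(* In four variables, $$\mathcal C_8(4)=\mathcal C_{12}(4)=\mathcal C_{14}(4)=\mathcal C_{22}(4)=0.$$ More precisely, $$\begin{array}{c|c|c|c|c} d&\dim B^d(4)&\dim\mathcal H^d(B(4))&\dim Q_d(B(4))&\dim\mathcal C_d(4)\\ \hline 8&15&11&4&0\\ 12&34&32&2&0\\ 14&47&43&4&0\\ 22&136&129&7&0. \end{array}$$ Consequently, for $d\in\{8,12,14,22\}$, every element of $B^d(4)$ that is hit in $P(4)$ is hit in $B(4)$.
   Context: $P(4)=\mathbf F_2[x_1,\dots,x_4]$, $|x_i|=1$; the total Steenrod square $\mathrm{Sq}=\sum_r\mathrm{Sq}^r$ is the algebra endomorphism with $\mathrm{Sq}(x_i)=x_i+x_i^2$. $\Sigma_4$ permutes the variables and $B(4)=P(4)^{\Sigma_4}$. For $M=P(4)$ or $B(4)$, $\mathcal H^d(M)=\sum_{r>0}\mathrm{Sq}^r(M^{d-r})$ (its elements are called hit in $M$) and $Q_d(M)=M^d/\mathcal H^d(M)$. The relative cohit space is $\mathcal C_d(4)=\ker\big(Q_d(B(4))\to Q_d(P(4))\big)=\big(B^d(4)\cap\mathcal H^d(P(4))\big)/\mathcal H^d(B(4))$. Dimensions are over $\mathbf F_2$. *)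

(* Defs.v *)
From HB Require Import structures.
From mathcomp Require Import all_boot perm all_algebra bigenough mpoly.

Set Implicit Arguments.
Unset Strict Implicit.
Unset Printing Implicit Defensive.

Import GRing.Theory BigEnough.
Local Open Scope ring_scope.
Local Open Scope quotient_scope.

Section VectorQuotient.
Context (F : fieldType) (vT : vectType F).
Implicit Types U V W : {vspace vT}.

Definition vquot V : Type := Quotient.quot (pred_of_vspace V : zmodClosed vT).

HB.instance Definition _ V := GRing.Zmodule.on (vquot V).

Definition vcls V (x : vT) : vquot V := \pi x.

Lemma vcls_eq V x y : (vcls V x == vcls V y) = (x - y \in V).
Proof. by rewrite /vcls -Quotient.idealrBE. Qed.

Lemma vcls_repr V (q : vquot V) : vcls V (repr q) = q.
Proof. exact: reprK. Qed.

Lemma vclsD V x y : vcls V (x + y) = vcls V x + vcls V y.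
Proof. exact: Quotient.pi_add. Qed.

Definition vquot_scale V (a : F) (q : vquot V) := vcls V (a *: repr q).

Lemma vclsZ V a x : vquot_scale a (vcls V x) = vcls V (a *: x).
Proof.
apply/eqP; rewrite /vquot_scale vcls_eq -scalerBr rpredZ //.
by rewrite -vcls_eq vcls_repr.
Qed.

Section Module.
Variable V : {vspace vT}.
Implicit Types (p q : vquot V).

Fact vquot_scaleA a b q :
  vquot_scale a (vquot_scale b q) = vquot_scale (a * b) q.
Proof. by rewrite -(vcls_repr q) !vclsZ scalerA. Qed.

Fact vquot_scale1 : left_id 1 (@vquot_scale V).
Proof. by move=> q; rewrite -(vcls_repr q) vclsZ scale1r. Qed.

Fact vquot_scaleDr : right_distributive (@vquot_scale V) +%R.
Proof.
move=> a p q; rewrite -(vcls_repr p) -(vcls_repr q) -vclsD !vclsZ.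
by rewrite scalerDr vclsD.
Qed.

Fact vquot_scaleDl q : {morph (@vquot_scale V)^~ q : a b / a + b}.
Proof. by move=> a b; rewrite -(vcls_repr q) !vclsZ scalerDl vclsD. Qed.

HB.instance Definition _ := GRing.Zmodule_isLmodule.Build F (vquot V)
  vquot_scaleA vquot_scale1 vquot_scaleDr vquot_scaleDl.

Fact vcls_is_linear : linear (vcls V).
Proof. by move=> a x y; rewrite vclsD -vclsZ. Qed.

HB.instance Definition _ :=
  GRing.isLinear.Build F vT (vquot V) _ (vcls V) vcls_is_linear.

(* Coordinates of the component along V^C of a representative. *)
Let coords (q : vquot V) : 'rV[F]_(\dim V^C) :=
  \row_i coord (vbasis V^C) i (repr q - projv V (repr q)).

Let coords_cls x :
  coords (vcls V x) = \row_i coord (vbasis V^C) i (x - projv V x).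
Proof.
apply/rowP=> i; rewrite !mxE; set y := repr _; congr (coord _ i _).
have Vyx : y - x \in V by rewrite -vcls_eq vcls_repr.
rewrite -(subrK x y) (linearD (projv V)) /= (projv_id Vyx).
by rewrite opprD addrACA subrr add0r.
Qed.

Fact vquot_vector_axiom : Vector.axiom (\dim V^C) (vquot V).
Proof.
exists coords => [a p q | ].
  rewrite -(vcls_repr p) -(vcls_repr q) -linearP !coords_cls.
  apply/rowP=> i; rewrite !mxE (linearP (projv V)) opprD addrACA -scalerBr.
  by rewrite linearP.
exists (fun r : 'rV_(\dim V^C) =>
    vcls V (\sum_i r 0 i *: (vbasis V^C)`_i)) => [q | r].
  rewrite -{2}(vcls_repr q); apply/eqP.
  under eq_bigr do rewrite mxE.
  rewrite -(coord_vbasis (memv_projC _ _)) vcls_eq.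
  by rewrite addrAC subrr add0r rpredN memv_proj.
rewrite coords_cls; set u := \sum_i _.
have uVC : u \in V^C%VS.
  by apply: rpred_sum => i _; rewrite rpredZ // vbasis_mem // memt_nth.
have -> : projv V u = 0.
  have := daddv_pi_add (w := u) (capv_compl V).
  rewrite addv_complf memvf => /(_ isT) /eqP.
  rewrite [X in _ + X]daddv_pi_id //; last by rewrite capvC capv_compl.
  by rewrite -[X in _ == X]add0r (inj_eq (addIr _)) => /eqP.
apply/rowP=> i; rewrite mxE subr0 coord_sum_free //.
exact: basis_free (vbasisP _).
Qed.

HB.instance Definition _ :=
  Lmodule_hasFinDim.Build F (vquot V) vquot_vector_axiom.

Definition vproj : 'Hom(vT, vquot V) := linfun (vcls V).

Lemma lker_vproj : lker vproj = V.
Proof.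
apply/vspaceP=> x; rewrite memv_ker lfunE /= -(linear0 (vcls V)) vcls_eq.
by rewrite subr0.
Qed.

Lemma limg_vproj : limg vproj = fullv.
Proof.
apply/vspaceP=> q; rewrite memvf -(vcls_repr q); apply/memv_imgP.
by exists (repr q); rewrite ?memvf // lfunE.
Qed.

End Module.

(* The map vT / V -> vT / W induced by the identity, meaningful for V <= W. *)
Definition vquot_map V W : 'Hom(vquot V, vquot W) :=
  (vproj W \o (vproj V)^-1)%VF.

Lemma vquot_mapE V W x :
  (V <= W)%VS -> vquot_map V W (vproj V x) = vproj W x.
Proof.
move=> sVW; rewrite comp_lfunE; apply/eqP; rewrite -subr_eq0 -linearB /=.
rewrite -memv_ker lker_vproj (subvP sVW) //.
have /eqP := limg_lfunVK (memv_img (vproj V) (memvf x)).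
by rewrite -subr_eq0 -linearB /= -memv_ker lker_vproj.
Qed.

(* U / V for V <= U, as a subspace of vT / V. *)
Definition subquot U V : {vspace vquot V} := (vproj V @: U)%VS.

Lemma dim_subquot U V : (V <= U)%VS -> \dim (subquot U V) = (\dim U - \dim V)%N.
Proof.
move=> sVU; have := limg_ker_dim (vproj V) U; rewrite lker_vproj.
by move/capv_idPr: sVU => -> <-; rewrite addKn.
Qed.

End VectorQuotient.

Notation P4 d := (dhomog 4 'F_2 d).

(* A graded subspace M of F_2[x_1, .., x_4] is given by its components M^d. *)
Notation gradedSpace := (forall d : nat, {vspace P4 d}).

Definition P4full : gradedSpace := fun d => fullv.

Definition hcomp d (f : {mpoly 'F_2[4]}) : P4 d := DHomog (pihomogP mdeg d f).

Fact hcomp_is_linear d : linear (hcomp d).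
Proof. by move=> a f g; apply: val_inj; rewrite /= linearP. Qed.

HB.instance Definition _ d :=
  GRing.isLinear.Build 'F_2 {mpoly 'F_2[4]} (P4 d) _ (hcomp d)
    (@hcomp_is_linear d).

Definition permP d (s : 'S_4) : 'End(P4 d) :=
  linfun (hcomp d \o msym s \o @mpoly_of_dhomog 4 'F_2 d).

Lemma permPE d s (f : P4 d) : val (permP d s f) = msym s (val f).
Proof. by rewrite lfunE /= -msym_pihomog pihomog_dE // dhomog_is_dhomog. Qed.

Definition B4 : gradedSpace := fun d =>
  (\bigcap_(s : 'S_4) fixedSpace (permP d s))%VS.

Lemma mem_B4 d (f : P4 d) : (f \in B4 d) = (val f \is symmetric).
Proof.
apply/idP/issymP => [Bf s | symf].
  rewrite -permPE; congr val; apply/fixedSpaceP.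
  exact: subvP (bigcapv_inf s isT (subvv _)) _ Bf.
rewrite memvE; apply/subv_bigcapP=> s _; rewrite -memvE.
by apply/fixedSpaceP/val_inj; rewrite permPE symf.
Qed.

Definition Sqtot (f : {mpoly 'F_2[4]}) : {mpoly 'F_2[4]} :=
  f \mPo [tuple 'X_i + 'X_i ^+ 2 | i < 4].

Fact Sqtot_is_linear : linear Sqtot.
Proof. exact: linearP. Qed.

HB.instance Definition _ :=
  GRing.isLinear.Build 'F_2 {mpoly 'F_2[4]} {mpoly 'F_2[4]} _ Sqtot
    Sqtot_is_linear.

(* Sq^r : P^{d-r} -> P^d, for r <= d: the component of degree d of the total
   square. *)
Definition Sq d r : 'Hom(P4 (d - r), P4 d) :=
  linfun (hcomp d \o Sqtot \o @mpoly_of_dhomog 4 'F_2 (d - r)).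

Lemma SqE d r (f : P4 (d - r)) : val (Sq d r f) = pihomog mdeg d (Sqtot (val f)).
Proof. by rewrite lfunE. Qed.

Definition hit (M : gradedSpace) d : {vspace P4 d} :=
  (\sum_(r < d.+1 | (0 < r)%N) (Sq d r @: M (d - r)%N))%VS.

Lemma hitS (M N : gradedSpace) d :
  (forall e, (M e <= N e)%VS) -> (hit M d <= hit N d)%VS.
Proof.
move=> sMN; apply/subv_sumP=> r r0; apply: (sumv_sup r) => //.
exact: limgS (sMN _).
Qed.

Lemma Sqtot_msym s f : Sqtot (msym s f) = msym s (Sqtot f).
Proof.
rewrite /Sqtot msym_mPo; pose_big_enough l.
  rewrite !(comp_mpolywE _ (w := l)) // raddf_sum; apply: eq_bigr => m _ /=.
  rewrite linearZ rmorph_prod /=; congr (_ *: _); apply: eq_bigr => i _.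
  by rewrite rmorphXn !tnth_mktuple rmorphD rmorphXn /= /msym mmapX mmap1U.
by close.
Qed.

Lemma hit_B4 d : (hit B4 d <= B4 d)%VS.
Proof.
apply/subv_sumP=> r r0; apply/subvP=> _ /memv_imgP[f Bf ->].
move: Bf; rewrite !mem_B4 SqE => /issymP symf; apply/pihomog_sym/issymP=> s.
by rewrite -Sqtot_msym symf.
Qed.

Definition cohit (M : gradedSpace) d : {vspace vquot (hit M d)} :=
  subquot (M d) (hit M d).

(* The kernel of Q_d(B(4)) -> Q_d(P(4)). *)
Definition relcohit d : {vspace vquot (hit B4 d)} :=
  (cohit B4 d :&: lker (vquot_map (hit B4 d) (hit P4full d)))%VS.

Lemma relcohitE d : relcohit d = subquot (B4 d :&: hit P4full d)%VS (hit B4 d).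
Proof.
have sH : (hit B4 d <= hit P4full d)%VS by apply: hitS => e; apply: subvf.
apply/vspaceP=> q; rewrite memv_cap; apply/andP/memv_imgP.
  case=> /memv_imgP[f Bf ->]; rewrite memv_ker vquot_mapE // -memv_ker.
  by rewrite lker_vproj => Hf; exists f; rewrite ?memv_cap ?Bf.
case=> f; rewrite memv_cap => /andP[Bf Hf] ->; rewrite memv_img //.
by rewrite memv_ker vquot_mapE // -memv_ker lker_vproj.
Qed.

(* Main.v *)
From HB Require Import structures.
Require Import Defs.
From mathcomp Require Import all_boot perm all_algebra mpoly.

(* The dual of Sq maps the functional "coefficient of x^e" to the sum of the
   coefficients of all x^s such that x^e occurs in Sq(x^s); a sum of coefficient
   functionals of degree d whose lower-degree images cancel therefore vanishes
   on every hit polynomial.  In each of the four degrees there are q such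
   functionals (q = 4, 2, 4, 7) forming, on q monomial symmetric functions, a
   basis dual to them.  Modulo these q functions, squares of monomial symmetric
   functions of lower degree produce successively all the others, so that
   dim B^d <= dim H^d(B) + q, whereas the functionals cut out of B^d a subspace
   of codimension q containing B^d /\ H^d(P).  As H^d(B) lies in the latter,
   both have codimension q in B^d, and they coincide. *)

Set Implicit Arguments.
Unset Strict Implicit.
Unset Printing Implicit Defensive.

Import GRing.Theory.

(** * Exponent sequences *)

Fixpoint bounded_parts k b d : seq (seq nat) :=
  if k is k'.+1 then
    [seq a :: s | a <- iota 0 (minn b d).+1, s <- bounded_parts k' a (d - a)]
  else if d is 0 then [:: [::]] else [::].

(** Partitions of [d] into at most four parts, padded with zeros; they index the monomial symmetric
    functions of degree [d]. *)
Definition parts d := bounded_parts 4 d d.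

Lemma mem_bounded_parts k b d s :
  (s \in bounded_parts k b d) =
  [&& size s == k, path geq b s & sumn s == d].
Proof.
elim: k b d s => [|k IHk] b d s; first by case: d => [|d]; case: s.
rewrite (_ : bounded_parts k.+1 b d =
  [seq a :: t | a <- iota 0 (minn b d).+1, t <- bounded_parts k a (d - a)]) //.
apply/allpairsPdep/and3P => [[a [t []]]|[]].
  rewrite mem_iota leq0n add0n ltnS leq_min => /and3P[_ ab ad].
  rewrite IHk => /and3P[/eqP <- pt /eqP st] ->; split => //=.
    by rewrite ab.
  by rewrite st subnKC.
case: s => [|a t] // /eqP[st] /andP[ab]; rewrite -/(path geq a t) => pt /eqP <-.
exists a, t; rewrite mem_iota leq0n add0n ltnS leq_min leq_addr [b >= a]ab.
by rewrite IHk pt st addKn !eqxx.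
Qed.

Lemma bounded_parts_uniq k b d : uniq (bounded_parts k b d).
Proof.
elim: k b d => [|k IHk] b d; first by case: d.
apply: allpairs_uniq_dep => [|a _|]; rewrite ?iota_uniq ?IHk //.
by move=> [a s] [a' s'] _ _ /= [-> ->].
Qed.

Lemma geq_trans : transitive geq.
Proof. by move=> n m p mn np; apply: leq_trans np mn. Qed.

Lemma geq_total : total geq.
Proof. by move=> m n; apply: leq_total. Qed.

Lemma geq_anti : antisymmetric geq.
Proof. by move=> m n nm; apply: anti_leq; rewrite andbC. Qed.

Lemma mem_parts d s :
  (s \in parts d) = [&& size s == 4, sorted geq s & sumn s == d].
Proof.
rewrite mem_bounded_parts; case: s => [|a s] //=.
apply/and3P/and3P=> [[-> /andP[_ ->] ->] // | [-> -> /eqP <-]].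
by rewrite leq_addr.
Qed.

Lemma perm_parts s t : sorted geq t -> perm_eq s t = (sort geq s == t).
Proof.
move=> st; rewrite -{2}(sorted_sort geq_trans st).
by apply/(perm_sortP geq_total geq_trans geq_anti)/eqP.
Qed.

(* The b such that x^a occurs in Sq(x^b) = (x + x^2)^b. *)
Definition sq_preimages a := [seq b <- iota 0 a.+1 | odd 'C(b, a - b)].

(* In the form [tbl = mkseq sq_preimages N], the table [tbl] makes each list of
   preimages be evaluated only once. *)
Fixpoint sq_dual (tbl : seq (seq nat)) (e : seq nat) : seq (seq nat) :=
  if e is a :: e' then
    [seq b :: s | b <- nth [::] tbl a, s <- sq_dual tbl e']
  else [:: [::]].

Lemma mem_sq_dual tbl e s :
  (s \in sq_dual tbl e) = all2 (fun b a => b \in nth [::] tbl a) s e.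
Proof.
elim: e s => [|a e IHe] [|b s] //=; first by apply/allpairsPdep => -[? [? []]].
rewrite -IHe; apply/allpairsPdep/andP=> [[c [t [? ? [-> ->]]]] | []] //.
by exists b, s.
Qed.

Lemma size_sq_dual tbl e s : s \in sq_dual tbl e -> size s = size e.
Proof. by rewrite mem_sq_dual all2E => /andP[/eqP]. Qed.

Lemma sq_dual_uniq N e : uniq (sq_dual (mkseq sq_preimages N) e).
Proof.
elim: e => //= a e IHe; apply: allpairs_uniq => //.
  (* Outside the table [nth] returns the empty list, which has no repetitions. *)
  have [aN|Na] := ltnP a N; last by rewrite nth_default ?size_mkseq.
  by rewrite nth_mkseq // filter_uniq ?iota_uniq.
by move=> [b s] [b' s'] _ _ /= [-> ->].
Qed.

Fixpoint paired (T : eqType) (s : seq T) : bool :=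
  if s is x :: s' then
    if s' is y :: s'' then (x == y) && paired s'' else false
  else true.

Lemma natrF2 n : (n%:R = (odd n)%:R :> 'F_2)%R.
Proof.
rewrite -{1}(odd_double_half n) natrD -muln2 natrM.
by rewrite (_ : 2%:R = 0 :> 'F_2)%R ?mulr0 ?addr0 //; apply: val_inj.
Qed.

Lemma sum_paired (T : eqType) (F : T -> 'F_2) s :
  paired s -> (\sum_(x <- s) F x = 0)%R.
Proof.
have [n] := ubnP (size s); elim: n s => // n IHn [|x [|y s]] //=.
  by rewrite big_nil.
rewrite ltnS => sn /andP[/eqP-> ps].
rewrite !big_cons IHn //; last by apply: leq_trans sn; apply: leqnSn.
by rewrite addr0 -mulr2n -mulr_natl natrF2 mul0r.
Qed.

Fixpoint lexleq s t : bool :=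
  match s, t with
  | a :: s', b :: t' => (a < b)%N || ((a == b) && lexleq s' t')
  | [::], _ => true
  | _, [::] => false
  end.

(* Sorting brings equal terms together, so the test accepts [S] when every
   monomial of degree < d occurs an even number of times in the dual squares
   of the monomials of [S]. *)
Definition annihilating tbl d (S : seq (seq nat)) :=
  all (fun e => (size e == 4) && (sumn e == d)) S &&
  paired (sort lexleq
    [seq s <- flatten [seq sq_dual tbl e | e <- S] | (sumn s < d)%N]).

(** The multiplicity of a partition [m] in the row of [p], modulo 2, is the coefficient of x^p in
    the total square of the monomial symmetric function of [m]. *)
Definition sq_rows tbl P : seq (seq nat * seq (seq nat)) :=
  [seq (p, [seq sort geq s | s <- sq_dual tbl p]) | p <- P].

(* A square in which exactly one of the remaining monomial symmetric functions
   occurs eliminates that function. *)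
Definition sq_eliminate (U : seq (seq nat * seq (seq nat))) (m : seq nat) :=
  if size [seq u <- U | odd (count_mem m u.2)] == 1
  then [seq u <- U | ~~ odd (count_mem m u.2)] else U.

Definition lower_parts d := flatten [seq parts e | e <- rev (iota 0 d)].

(** The functionals [L] must form the identity matrix on the pivots [G]. The squares are tried in
    three passes, since one that is useless at first may isolate a single function after other
    eliminations. *)
Definition certificate d (L : seq (seq (seq nat))) (G : seq (seq nat)) :=
  let tbl := mkseq sq_preimages d.+1 in
  [&& size L == size G, all (annihilating tbl d) L,
    all (fun g => g \in parts d) G,
    all (fun i => all (fun j =>
        odd (count (perm_eq^~ (nth [::] G j)) (nth [::] L i)) == (i == j))
      (iota 0 (size G))) (iota 0 (size G))
  & nilp (foldl sq_eliminate
      (sq_rows tbl [seq p <- parts d | p \notin G])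
      (flatten (nseq 3 (lower_parts d))))].

(** * Certificates *)

(* Sums of dual monomials in three or four variables annihilated by the dual
   squares, found by linear algebra.  Since x^15 and x^7 are not hit, prefixing
   the exponent 15 or 7 to such a sum preserves this property. *)
Definition annihilated3_7 : seq (seq nat) := [::
    [:: 1; 1; 5]; [:: 1; 2; 4]; [:: 1; 4; 2]; [:: 1; 5; 1]; [:: 2; 1; 4];
    [:: 2; 2; 3]; [:: 2; 3; 2]; [:: 2; 4; 1]; [:: 3; 2; 2]; [:: 4; 1; 2];
    [:: 4; 2; 1]; [:: 5; 1; 1]].

Definition annihilated3_15 : seq (seq nat) := [::
    [:: 1; 1; 13]; [:: 1; 2; 12]; [:: 1; 3; 11]; [:: 1; 4; 10]; [:: 1; 5; 9];
    [:: 1; 6; 8]; [:: 1; 8; 6]; [:: 1; 9; 5]; [:: 1; 10; 4]; [:: 1; 11; 3];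
    [:: 1; 12; 2]; [:: 1; 13; 1]; [:: 2; 1; 12]; [:: 2; 2; 11]; [:: 2; 3; 10];
    [:: 2; 4; 9]; [:: 2; 5; 8]; [:: 2; 6; 7]; [:: 2; 7; 6]; [:: 2; 8; 5];
    [:: 2; 9; 4]; [:: 2; 10; 3]; [:: 2; 11; 2]; [:: 2; 12; 1]; [:: 3; 1; 11];
    [:: 3; 2; 10]; [:: 3; 3; 9]; [:: 3; 4; 8]; [:: 3; 6; 6]; [:: 3; 8; 4];
    [:: 3; 9; 3]; [:: 3; 10; 2]; [:: 3; 11; 1]; [:: 4; 1; 10]; [:: 4; 2; 9];
    [:: 4; 3; 8]; [:: 4; 4; 7]; [:: 4; 5; 6]; [:: 4; 6; 5]; [:: 4; 7; 4];
    [:: 4; 8; 3]; [:: 4; 9; 2]; [:: 4; 10; 1]; [:: 5; 1; 9]; [:: 5; 2; 8];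
    [:: 5; 4; 6]; [:: 5; 5; 5]; [:: 5; 6; 4]; [:: 5; 8; 2]; [:: 5; 9; 1];
    [:: 6; 1; 8]; [:: 6; 2; 7]; [:: 6; 3; 6]; [:: 6; 4; 5]; [:: 6; 5; 4];
    [:: 6; 6; 3]; [:: 6; 7; 2]; [:: 6; 8; 1]; [:: 7; 2; 6]; [:: 7; 4; 4];
    [:: 7; 6; 2]; [:: 8; 1; 6]; [:: 8; 2; 5]; [:: 8; 3; 4]; [:: 8; 4; 3];
    [:: 8; 5; 2]; [:: 8; 6; 1]; [:: 9; 1; 5]; [:: 9; 2; 4]; [:: 9; 3; 3];
    [:: 9; 4; 2]; [:: 9; 5; 1]; [:: 10; 1; 4]; [:: 10; 2; 3]; [:: 10; 3; 2];
    [:: 10; 4; 1]; [:: 11; 1; 3]; [:: 11; 2; 2]; [:: 11; 3; 1]; [:: 12; 1; 2];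
    [:: 12; 2; 1]; [:: 13; 1; 1]].

Definition annihilated4_14 : seq (seq nat) := [::
    [:: 1; 1; 6; 6]; [:: 1; 2; 5; 6]; [:: 1; 3; 5; 5]; [:: 1; 4; 3; 6];
    [:: 1; 5; 5; 3]; [:: 1; 6; 1; 6]; [:: 1; 6; 2; 5]; [:: 1; 6; 4; 3];
    [:: 2; 1; 6; 5]; [:: 2; 2; 5; 5]; [:: 2; 3; 3; 6]; [:: 2; 4; 3; 5];
    [:: 2; 5; 1; 6]; [:: 2; 5; 2; 5]; [:: 2; 5; 4; 3]; [:: 2; 6; 3; 3];
    [:: 3; 1; 5; 5]; [:: 3; 2; 6; 3]; [:: 3; 3; 3; 5]; [:: 3; 4; 1; 6];
    [:: 3; 4; 2; 5]; [:: 3; 4; 4; 3]; [:: 4; 1; 6; 3]; [:: 4; 2; 5; 3];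
    [:: 4; 3; 1; 6]; [:: 4; 3; 2; 5]; [:: 4; 3; 4; 3]; [:: 4; 4; 3; 3];
    [:: 5; 1; 3; 5]; [:: 5; 2; 1; 6]; [:: 5; 2; 2; 5]; [:: 5; 2; 4; 3];
    [:: 6; 1; 1; 6]; [:: 6; 1; 2; 5]; [:: 6; 1; 4; 3]; [:: 6; 2; 3; 3]].

Definition annihilated4_22 : seq (seq nat) := [::
    [:: 1; 3; 5; 13]; [:: 1; 3; 6; 12]; [:: 1; 3; 12; 6]; [:: 1; 3; 13; 5];
    [:: 1; 5; 3; 13]; [:: 1; 5; 6; 10]; [:: 1; 5; 10; 6]; [:: 1; 5; 13; 3];
    [:: 1; 6; 3; 12]; [:: 1; 6; 5; 10]; [:: 1; 6; 10; 5]; [:: 1; 6; 12; 3];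
    [:: 1; 10; 5; 6]; [:: 1; 10; 6; 5]; [:: 1; 12; 3; 6]; [:: 1; 12; 6; 3];
    [:: 1; 13; 3; 5]; [:: 1; 13; 5; 3]; [:: 2; 3; 5; 12]; [:: 2; 3; 6; 11];
    [:: 2; 3; 11; 6]; [:: 2; 3; 12; 5]; [:: 2; 5; 3; 12]; [:: 2; 5; 6; 9];
    [:: 2; 5; 9; 6]; [:: 2; 5; 12; 3]; [:: 2; 6; 3; 11]; [:: 2; 6; 5; 9];
    [:: 2; 6; 9; 5]; [:: 2; 6; 11; 3]; [:: 2; 9; 5; 6]; [:: 2; 9; 6; 5];
    [:: 2; 11; 3; 6]; [:: 2; 11; 6; 3]; [:: 2; 12; 3; 5]; [:: 2; 12; 5; 3];
    [:: 3; 3; 3; 13]; [:: 3; 3; 6; 10]; [:: 3; 3; 10; 6]; [:: 3; 6; 3; 10];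
    [:: 3; 6; 6; 7]; [:: 3; 6; 7; 6]; [:: 3; 6; 10; 3]; [:: 3; 7; 6; 6];
    [:: 3; 10; 3; 6]; [:: 3; 10; 6; 3]; [:: 4; 3; 5; 10]; [:: 4; 3; 6; 9];
    [:: 4; 3; 9; 6]; [:: 4; 3; 10; 5]; [:: 4; 5; 3; 10]; [:: 4; 5; 6; 7];
    [:: 4; 5; 7; 6]; [:: 4; 5; 10; 3]; [:: 4; 6; 3; 9]; [:: 4; 6; 5; 7];
    [:: 4; 6; 7; 5]; [:: 4; 6; 9; 3]; [:: 4; 7; 5; 6]; [:: 4; 7; 6; 5];
    [:: 4; 9; 3; 6]; [:: 4; 9; 6; 3]; [:: 4; 10; 3; 5]; [:: 4; 10; 5; 3];
    [:: 5; 3; 3; 11]; [:: 5; 3; 5; 9]; [:: 5; 3; 9; 5]; [:: 5; 5; 3; 9];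
    [:: 5; 5; 5; 7]; [:: 5; 5; 7; 5]; [:: 5; 5; 9; 3]; [:: 5; 7; 5; 5];
    [:: 5; 9; 3; 5]; [:: 5; 9; 5; 3]; [:: 7; 3; 7; 5]; [:: 7; 7; 3; 5];
    [:: 9; 3; 7; 3]; [:: 9; 7; 3; 3]].

(** The one-term functionals, here and below, are coefficients of spikes: an exponent 2^k - 1 has no
    preimage but itself. *)
Definition functionals8 : seq (seq (seq nat)) :=
  [:: [:: [:: 7; 1; 0; 0]];
      [:: [:: 3; 3; 1; 1]];
      [:: [:: 0; 1; 1; 6]; [:: 0; 1; 2; 5]; [:: 0; 1; 4; 3]; [:: 0; 2; 3; 3]];
      [:: [:: 1; 3; 2; 2]; [:: 1; 5; 1; 1]; [:: 2; 3; 1; 2]; [:: 2; 3; 2; 1]]].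

Definition pivots8 :=
  [:: [:: 7; 1; 0; 0]; [:: 3; 3; 1; 1]; [:: 3; 3; 2; 0]; [:: 3; 2; 2; 1]].

Definition functionals12 : seq (seq (seq nat)) :=
  [:: [:: [:: 7; 3; 1; 1]]; [:: [:: 3; 3; 3; 3]]].

Definition pivots12 := [:: [:: 7; 3; 1; 1]; [:: 3; 3; 3; 3]].

Definition functionals14 : seq (seq (seq nat)) :=
  [:: [:: [:: 7; 7; 0; 0]]; [:: [:: 7; 3; 3; 1]];
      [seq 7 :: s | s <- annihilated3_7]; annihilated4_14].

Definition pivots14 :=
  [:: [:: 7; 7; 0; 0]; [:: 7; 3; 3; 1]; [:: 7; 3; 2; 2]; [:: 4; 4; 3; 3]].

(** In the last functional, adding [annihilated4_22] cancels the value 1 that the first summand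
    takes at the pivot [[:: 7; 5; 5; 5]]. *)
Definition functionals22 : seq (seq (seq nat)) :=
  [:: [:: [:: 15; 7; 0; 0]]; [:: [:: 15; 3; 3; 1]]; [:: [:: 7; 7; 7; 1]];
      [seq 15 :: s | s <- annihilated3_7];
      [:: [:: 3; 3; 3; 13]; [:: 3; 3; 5; 11]; [:: 3; 3; 9; 7]; [:: 3; 5; 7; 7]];
      annihilated4_22; [seq 7 :: s | s <- annihilated3_15] ++ annihilated4_22].

Definition pivots22 :=
  [:: [:: 15; 7; 0; 0]; [:: 15; 3; 3; 1]; [:: 7; 7; 7; 1]; [:: 15; 3; 2; 2];
      [:: 7; 7; 5; 3]; [:: 7; 5; 5; 5]; [:: 7; 7; 4; 4]].

Lemma certificate8 : certificate 8 functionals8 pivots8.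
Proof. by vm_compute. Qed.
Lemma certificate12 : certificate 12 functionals12 pivots12.
Proof. by vm_compute. Qed.
Lemma certificate14 : certificate 14 functionals14 pivots14.
Proof. by vm_compute. Qed.
Lemma certificate22 : certificate 22 functionals22 pivots22.
Proof. by vm_compute. Qed.

Local Open Scope ring_scope.

(** * Coefficients of total squares *)

Definition mon (s : seq nat) : 'X_{1..4} := [multinom nth 0%N s i | i < 4].

Lemma mon_seq (m : 'X_{1..4}) : mon m = m.
Proof. by apply/mnmP => i; rewrite mnmE [RHS](tnth_nth 0%N). Qed.

Lemma seq_mon s : size s = 4 -> mon s = s :> seq nat.
Proof.
move=> s4; apply: (@eq_from_nth _ 0%N); rewrite size_tuple ?s4 // => i i4.
by rewrite -[i]/(val (Ordinal i4)) -tnth_nth tnth_mktuple.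
Qed.

Lemma mdeg_mon s : size s = 4 -> mdeg (mon s) = sumn s.
Proof. by move=> s4; rewrite /mdeg -sumnE seq_mon. Qed.

Lemma eq_mon (m : 'X_{1..4}) s :
  size s = 4 -> (m == mon s) = ((m : seq nat) == s).
Proof.
move=> s4; apply/eqP/eqP => [->|<-]; first exact: seq_mon.
by rewrite mon_seq.
Qed.

Lemma mcoeff_pihomog d (f : {mpoly 'F_2[4]}) m :
  (pihomog mdeg d f)@_m = if mdeg m == d then f@_m else 0.
Proof.
have [md|md] := eqVneq (mdeg m) d; last first.
  exact: dhomog_nemf_coeff (pihomogP _ _ _) md.
rewrite pihomogE [in RHS](mpolyE f) !raddf_sum /= big_mkcond.
apply: eq_bigr => m' _.
rewrite mcoeffZ mcoeffX; case: (eqVneq m' m) => [->|]; rewrite ?md ?eqxx //.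
by rewrite mulr0; case: ifP.
Qed.

Lemma prod_natr_bool (I : finType) (R : comNzRingType) (b : pred I) :
  \prod_i (b i)%:R = [forall i, b i]%:R :> R.
Proof.
case: forallP => [bT | /forallP]; first by rewrite big1 // => i _; rewrite bT.
by rewrite negb_forall => /existsP[i /negPf bi]; rewrite (bigD1 i) //= bi mul0r.
Qed.

(** In (x + x^2)^n, the sum of the 'C(n, k) x^(n + k), only k = a - n can produce x^a; the bound on
    [a] keeps this k in range. *)
Lemma sum_sq_exponent N n a : (a < N)%N ->
  \sum_(k < N) 'C(n, k)%:R * (n + k == a)%N%:R
    = (n \in sq_preimages a)%:R :> 'F_2.
Proof.
move=> aN; rewrite mem_filter mem_iota leq0n add0n ltnS [_ && _]andbC.
have [na|an] := leqP n a; last first.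
  rewrite big1 // => k _.
  by rewrite gtn_eqF ?mulr0 // (leq_trans an) ?leq_addr.
rewrite (bigD1 (Ordinal (leq_ltn_trans (leq_subr n a) aN))) //=.
rewrite subnKC // eqxx mulr1 -natrF2 big1 ?addr0 // => k.
rewrite -val_eqE /= => /negPf kE.
by rewrite -[in X in _ == X](subnKC na) eqn_add2l kE mulr0.
Qed.

(** [Sqtot] is multiplicative, so the coefficient is a product of one-variable coefficients. The
    degree bound keeps the exponents of [e] inside the table. *)
Lemma Sqtot_mpolyX d (m e : 'X_{1..4}) : (mdeg e <= d)%N ->
  (Sqtot 'X_[m])@_e =
  ((m : seq nat) \in sq_dual (mkseq sq_preimages d.+1) e)%:R.
Proof.
move=> ed; have eid i : (e i < d.+1)%N.
  by rewrite ltnS; apply: leq_trans ed; rewrite mdegE (bigD1 i) //= leq_addr.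
(* A common range for all variables: it exceeds each [m i], so no binomial term is lost, and each
   [e i], as [sum_sq_exponent] requires. *)
pose N := (d + mdeg m).+1.
have sqE i : ('X_i + 'X_i ^+ 2) ^+ m i
    = \sum_(k < N) 'C(m i, k)%:R *: 'X_i ^+ (m i + k) :> {mpoly 'F_2[4]}.
  have miN : ((m i).+1 <= N)%N.
    by rewrite ltnS mdegE (bigD1 i) //= addnCA leq_addr.
  rewrite exprDn (big_ord_widen N (fun k => 'X_i ^+ (m i - k) *
    ('X_i ^+ 2) ^+ k *+ 'C(m i, k) : {mpoly 'F_2[4]}) miN) big_mkcond.
  apply: eq_bigr => k _; rewrite ltnS; case: leqP => [ki|ik].
    by rewrite -exprM -exprD mul2n -addnn addnA subnK // scaler_nat.
  by rewrite bin_small // scale0r.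
rewrite /Sqtot comp_mpolyX; under eq_bigr do rewrite tnth_mktuple sqE.
rewrite bigA_distr_bigA /= raddf_sum /=.
(* A choice [h] of one term per variable contributes to x^e exactly when m + h = e in every
   variable. *)
rewrite (eq_bigr (fun h : {ffun 'I_4 -> 'I_N} =>
    \prod_i ('C(m i, h i)%:R * (m i + h i == e i)%N%:R))) => [|h _]; last first.
  rewrite scaler_prod mcoeffZ big_split prod_natr_bool /=; congr (_ * _).
  have -> : \prod_i 'X_i ^+ (m i + h i)
      = 'X_[[multinom (m i + h i)%N | i < 4]] :> {mpoly 'F_2[4]}.
    by rewrite mpolyXE_id; apply: eq_bigr => i _; rewrite mnmE.
  rewrite mcoeffX; congr ((nat_of_bool _)%:R); apply/eqP/forallP => [<- i|mhe].
    by rewrite mnmE.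
  by apply/mnmP => i; rewrite mnmE; apply/eqP.
(* The condition on [h] being a product over the variables, the sum over [h] factors again into
   one-variable sums. *)
rewrite -(bigA_distr_bigA (fun i (k : 'I_N) =>
  'C(m i, k)%:R * (m i + k == e i)%N%:R)) /=.
under eq_bigr => i _.
  rewrite sum_sq_exponent; last by rewrite (leq_trans (eid i)) // ltnS leq_addr.
  over.
have nthE (k : 'X_{1..4}) (i : 'I_4) : nth 0%N k i = k i by rewrite -tnth_nth.
rewrite prod_natr_bool mem_sq_dual all2E !size_tuple eqxx /=.
congr ((nat_of_bool _)%:R); apply/forallP/(all_nthP (0, 0)%N) => [me j | me i].
  rewrite size_zip !size_tuple minnn => j4; have := me (Ordinal j4).
  by rewrite nth_zip ?size_tuple //= !(nthE _ (Ordinal j4)) nth_mkseq.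
have := me i; rewrite size_zip !size_tuple minnn => /(_ (ltn_ord i)).
by rewrite nth_zip ?size_tuple //= !nthE nth_mkseq.
Qed.

(** Linear extension of the monomial case: [sq_dual] is the transpose of [Sqtot]. *)
Lemma mcoeff_Sqtot d f e : size e = 4 -> (sumn e <= d)%N ->
  (Sqtot f)@_(mon e) =
  \sum_(s <- sq_dual (mkseq sq_preimages d.+1) e) f@_(mon s).
Proof.
move=> e4 ed; have coef_sum k : f@_k = \sum_(m <- msupp f) f@_m * (m == k)%:R.
  rewrite [LHS](congr1 (mcoeff k) (mpolyE f)) raddf_sum.
  by apply: eq_bigr => m _; rewrite /= mcoeffZ mcoeffX.
have -> : Sqtot f = \sum_(m <- msupp f) f@_m *: Sqtot 'X_[m].
  rewrite [LHS](congr1 Sqtot (mpolyE f)) linear_sum.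
  by under eq_bigr do rewrite linearZ.
rewrite raddf_sum (eq_bigr _ (fun s _ => coef_sum (mon s))) exchange_big /=.
apply: eq_bigr => m _; rewrite mcoeffZ -mulr_sumr; congr (_ * _).
rewrite (Sqtot_mpolyX _ (d := d)) ?mdeg_mon // seq_mon //.
rewrite -natr_sum; congr (_%:R).
rewrite -count_uniq_mem ?sq_dual_uniq // -sum1_count big_mkcond.
apply: eq_big_seq => s sD; rewrite eq_mon ?(size_sq_dual sD) // eq_sym.
by rewrite /=; case: (s == _).
Qed.

(** * Functionals and symmetric functions *)

Section Degree.
Variable d : nat.
Local Notation tbl := (mkseq sq_preimages d.+1).

Definition eval_mons (L : seq (seq (seq nat))) (f : P4 d) :
    'rV['F_2]_(size L) :=
  \row_i \sum_(e <- nth [::] L i) (val f)@_(mon e).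

Fact eval_mons_is_linear L : linear (eval_mons L).
Proof.
move=> a f g; apply/rowP => i; rewrite !mxE mulr_sumr -big_split.
by apply: eq_bigr => e _; rewrite /= mcoeffD mcoeffZ.
Qed.

HB.instance Definition _ L :=
  GRing.isLinear.Build 'F_2 (P4 d) 'rV['F_2]_(size L) _ (eval_mons L)
    (eval_mons_is_linear L).

Lemma sum_annihilating S r (f : P4 (d - r)) :
  annihilating tbl d S -> (0 < r <= d)%N ->
  \sum_(e <- S) (val (Sq d r f))@_(mon e) = 0.
Proof.
case/andP=> /allP Sd pS /andP[r0 rd]; rewrite SqE.
transitivity (\sum_(e <- S) \sum_(s <- sq_dual tbl e) (val f)@_(mon s)).
  apply: eq_big_seq => e /Sd /andP[/eqP e4 /eqP ed].
  by rewrite mcoeff_pihomog mdeg_mon // ed eqxx (mcoeff_Sqtot (d := d)) ?ed.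
have fE s : size s = 4 -> sumn s != (d - r)%N -> (val f)@_(mon s) = 0.
  move=> s4 sr; apply: (dhomog_nemf_coeff (d := d - r) (mf := mdeg)).
    exact: dhomog_is_dhomog.
  by move: sr; rewrite -(mdeg_mon s4).
rewrite -(big_map _ xpredT (fun D => \sum_(s <- D) (val f)@_(mon s))).
rewrite -big_flatten.
(* Preimages of degree below [d] cancel in pairs modulo 2; at the others [f], of degree d - r < d,
   has coefficient 0. *)
rewrite (bigID (fun s => (sumn s < d)%N)) /= -big_filter.
rewrite -(perm_big _ (permEl (perm_sort lexleq _))) sum_paired // add0r.
rewrite big_seq_cond big1 // => s.
case/andP=> /flatten_mapP[e /Sd /andP[/eqP e4 _] /size_sq_dual].
rewrite e4 => s4.
rewrite -leqNgt => ds; apply: fE => //; rewrite gtn_eqF //.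
by apply: leq_trans ds; rewrite ltn_subrL r0 (leq_trans r0).
Qed.

Lemma hit_annihilating L :
  all (annihilating tbl d) L ->
  (hit P4full d <= lker (linfun (eval_mons L)))%VS.
Proof.
move=> /(all_nthP [::]) aL; apply/subv_sumP => r r0.
apply/subvP => _ /memv_imgP[f _ ->].
rewrite memv_ker lfunE; apply/eqP/rowP => i; rewrite !mxE.
by apply: sum_annihilating; rewrite ?aL // r0 -ltnS ltn_ord.
Qed.

(** Rank-nullity: attaining all unit vectors makes the evaluation surjective on [U]. *)
Lemma dim_cap_eval (U : {vspace P4 d}) L :
  (forall i : 'I_(size L), exists2 g, g \in U & eval_mons L g = delta_mx 0 i) ->
  \dim U = (\dim (U :&: lker (linfun (eval_mons L))) + size L)%N.
Proof.
move=> UL; rewrite -(limg_ker_dim (linfun (eval_mons L))); congr addn.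
suff -> : (linfun (eval_mons L) @: U)%VS = fullv.
  by rewrite dimvf; apply: mul1n.
apply/vspaceP => v; rewrite memvf (row_sum_delta v) rpred_sum // => i _.
rewrite rpredZ //; have [g gU <-] := UL i.
by rewrite -[eval_mons L g]lfunE memv_img.
Qed.

Lemma mcoeff_perm_sum p (m : 'X_{1..4}) : size p = 4 ->
  (\sum_(s <- permutations p) 'X_[mon s] : {mpoly 'F_2[4]})@_m
    = (perm_eq m p)%:R.
Proof.
move=> p4; rewrite raddf_sum /= -mem_permutations.
rewrite -count_uniq_mem ?permutations_uniq // -sum1_count natr_sum.
rewrite [RHS]big_mkcond; apply: eq_big_seq => s /=.
rewrite mem_permutations => /perm_size; rewrite p4 => s4.
by rewrite mcoeffX eq_sym eq_mon // eq_sym; case: (s == m).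
Qed.

(** [permutations] lists distinct rearrangements, so each monomial of the orbit has coefficient 1.
    When [p] has four entries and sum [d], [hcomp] changes only the type. *)
Definition msf (p : seq nat) : P4 d :=
  hcomp d (\sum_(s <- permutations p) 'X_[mon s]).

Lemma mcoeff_msf p s : size p = 4 -> sumn p = d -> size s = 4 ->
  (val (msf p))@_(mon s) = (perm_eq s p)%:R.
Proof.
move=> p4 pd s4; rewrite mcoeff_pihomog mdeg_mon //.
have [sd|sd] := eqVneq (sumn s) d; first by rewrite mcoeff_perm_sum // seq_mon.
by case: (boolP (perm_eq s p)) sd => // /perm_sumn ->; rewrite pd eqxx.
Qed.

Lemma mcoeff_msym s (f : {mpoly 'F_2[4]}) m :
  f \is symmetric -> perm_eq s (m : 'X_{1..4}) -> f@_(mon s) = f@_m.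
Proof.
move=> /issymP symf sm.
have /tuple_permP[p sE] := sm.
rewrite -[in RHS](symf p) mcoeff_sym; congr (_@_ _).
apply/mnmP => i; rewrite !mnmE sE.
by rewrite -tnth_nth tnth_mktuple.
Qed.

Lemma msf_B4 p : size p = 4 -> msf p \in B4 d.
Proof.
move=> p4; rewrite mem_B4; apply/pihomog_sym/issymP => s; apply/mpolyP => m.
rewrite mcoeff_sym !mcoeff_perm_sum //; congr ((nat_of_bool _)%:R).
by apply: (permPl _ p); apply/tuple_permP; exists s.
Qed.

(** Each orbit of monomials contains exactly one with nonincreasing exponents, obtained by sorting,
    and a symmetric polynomial is constant on orbits. *)
Lemma symm_expansion (f : P4 d) : f \in B4 d ->
  f = \sum_(p <- parts d) (val f)@_(mon p) *: msf p.
Proof.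
rewrite mem_B4 => symf; apply/val_inj/mpolyP => m; rewrite !raddf_sum /=.
under [RHS]eq_bigr do rewrite mcoeffZ.
have [md|md] := eqVneq (mdeg m) d; last first.
  rewrite (dhomog_nemf_coeff (dhomog_is_dhomog f) md) big1 // => p _.
  by rewrite mcoeff_pihomog (negPf md) mulr0.
pose q := sort geq m.
have qm : perm_eq q m by rewrite perm_sort.
have q4 : size q = 4 by rewrite (perm_size qm) size_tuple.
have qP : q \in parts d.
  rewrite mem_parts q4 eqxx sort_sorted //=; last exact: geq_total.
  by rewrite (perm_sumn qm) -md /mdeg sumnE.
rewrite (bigD1_seq q) ?bounded_parts_uniq //= -(mcoeff_msym symf qm).
have mmsf p : p \in parts d -> (val (msf p))@_m = (q == p)%:R.
  rewrite mem_parts => /and3P[/eqP p4 sp _].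
  rewrite mcoeff_pihomog md eqxx mcoeff_perm_sum //.
  by rewrite perm_parts.
rewrite mmsf // eqxx mulr1 big_seq_cond big1 ?addr0 // => p /andP[pP pq].
by rewrite mmsf // eq_sym (negPf pq) mulr0.
Qed.

Lemma size_mem_parts p : p \in parts d -> size p = 4.
Proof. by rewrite mem_parts => /and3P[/eqP]. Qed.

Lemma sumn_mem_parts p : p \in parts d -> sumn p = d.
Proof. by rewrite mem_parts => /and3P[_ _ /eqP]. Qed.

Lemma eval_msf L g i :
  all (all (fun e => size e == 4)) L -> g \in parts d ->
  eval_mons L (msf g) 0 i = (odd (count (perm_eq^~ g) (nth [::] L i)))%:R.
Proof.
move=> /(all_nthP [::])/(_ i (ltn_ord i))/allP Li gP; rewrite mxE -natrF2.
rewrite -sum1_count natr_sum [RHS]big_mkcond; apply: eq_big_seq => e /Li/eqP e4.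
rewrite mcoeff_msf ?(size_mem_parts gP) ?(sumn_mem_parts gP) //.
by case: (perm_eq e g).
Qed.

Lemma dim_B4 : \dim (B4 d) = size (parts d).
Proof.
(* The coefficients at partitions are dual to the monomial symmetric functions, and by
   [symm_expansion] they have no common zero in [B4 d] but 0. *)
pose L := [seq [:: p] | p <- parts d].
have sL : size L = size (parts d) by rewrite size_map.
rewrite -[RHS]sL (@dim_cap_eval _ L) => [|i].
  suff -> : (B4 d :&: lker (linfun (eval_mons L)))%VS = 0%VS by rewrite dimv0.
  apply/eqP; rewrite -subv0; apply/subvP => f.
  rewrite memv_cap memv_ker lfunE /= => /andP[fB /eqP f0].
  rewrite memv0 (symm_expansion fB) big_seq big1 // => p pP.
  have pL : (index p (parts d) < size L)%N by rewrite sL index_mem.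
  have := congr1 (fun v : 'rV__ => v 0 (Ordinal pL)) f0; rewrite !mxE /=.
  rewrite (nth_map [::]) ?index_mem // nth_index // big_seq1 => ->.
  by rewrite scale0r.
have iP : (i < size (parts d))%N by rewrite -sL.
exists (msf (nth [::] (parts d) i)).
  by rewrite msf_B4 // size_mem_parts ?mem_nth.
apply/rowP => j; have jP : (j < size (parts d))%N by rewrite -sL.
rewrite eval_msf ?mem_nth //; last first.
  by apply/allP => _ /mapP[p pP ->]; rewrite /= andbT size_mem_parts.
rewrite mxE eqxx (nth_map [::]) //= addn0 oddb perm_parts; last first.
  by have := mem_nth [::] iP; rewrite mem_parts => /and3P[].
rewrite sorted_sort ?nth_uniq ?bounded_parts_uniq //; first exact: geq_trans.
by have := mem_nth [::] jP; rewrite mem_parts => /and3P[].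
Qed.

End Degree.

(** * Elimination *)

Section Elimination.
Variable d : nat.
Local Notation tbl := (mkseq sq_preimages d.+1).

(** The square raising the degree from [sumn m] to [d]; its source is typed by d - (d - sumn m),
    which equals [sumn m] as [sumn m] is at most [d]. *)
Lemma mcoeff_Sq_msf m p : (sumn m <= d)%N -> size m = 4 -> sorted geq m ->
  p \in parts d ->
  (val (Sq d (d - sumn m) (msf (d - (d - sumn m)) m)))@_(mon p)
    = (odd (count_mem m [seq sort geq s | s <- sq_dual tbl p]))%:R.
Proof.
move=> md m4 sm pP; have p4 := size_mem_parts pP; have pd := sumn_mem_parts pP.
rewrite SqE mcoeff_pihomog mdeg_mon // pd eqxx (mcoeff_Sqtot (d := d)) ?pd //.
rewrite -natrF2 count_map -sum1_count natr_sum [RHS]big_mkcond.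
apply: eq_big_seq => s /size_sq_dual s4.
by rewrite mcoeff_msf ?subKn ?s4 // perm_parts //=; case: eqP.
Qed.

Lemma mem_lower_parts m :
  m \in lower_parts d -> [/\ size m = 4, sorted geq m & (sumn m < d)%N].
Proof.
case/flatten_mapP=> e; rewrite mem_rev mem_iota => /andP[_ ed].
by rewrite mem_parts => /and3P[/eqP m4 sm /eqP ->].
Qed.

(** Invariant of the elimination: functions without a row are known to lie in [W], and the remaining
    rows are still genuine ones. *)
Definition spanned_outside (W : {vspace P4 d})
    (U : seq (seq nat * seq (seq nat))) :=
  {subset U <= sq_rows tbl (parts d)} /\
  {in parts d, forall p, p \notin unzip1 U -> msf d p \in W}.

(** The square is hit, hence in [W]. Apart from the eliminated function, every term of its expansion
    is in [W] or has coefficient 0, so the eliminated function is in [W] too. *)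
Lemma sq_eliminateP (W : {vspace P4 d}) U m :
  (hit B4 d <= W)%VS -> m \in lower_parts d ->
  spanned_outside W U -> spanned_outside W (sq_eliminate U m).
Proof.
move=> HW /mem_lower_parts[m4 sm md] [sU UW]; rewrite /sq_eliminate.
case: ifP => // Um; split=> [u|p pP pU'].
  by rewrite mem_filter => /andP[_ /sU].
have [pU|] := boolP (p \in unzip1 U); last exact: UW.
pose odd_row (u : seq nat * seq (seq nat)) := odd (count_mem m u.2).
have row_odd u : u \in U ->
    odd_row u = odd (count_mem m [seq sort geq s | s <- sq_dual tbl u.1]).
  by move/sU => /mapP[q _ ->].
have unique u v : u \in U -> v \in U -> odd_row u -> odd_row v -> u = v.
  move=> uU vU uo vo.
  have: u \in [seq u <- U | odd_row u] by rewrite mem_filter uo.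
  have: v \in [seq u <- U | odd_row u] by rewrite mem_filter vo.
  move: Um; rewrite -/odd_row; case: filter => [|w []] // _.
  by rewrite !inE => /eqP-> /eqP->.
have [u uU pE] := mapP pU.
have uo : odd_row u.
  apply: contraNT pU' => uo; apply/mapP; exists u => //.
  by rewrite mem_filter uo.
pose h := Sq d (d - sumn m) (msf (d - (d - sumn m)) m).
have hH : h \in hit B4 d.
  have rd : (d - sumn m < d.+1)%N by rewrite ltnS leq_subr.
  have r0 : (0 < Ordinal rd)%N by rewrite /= subn_gt0.
  apply: subvP (sumv_sup (Ordinal rd) r0 (subvv _)) _ _.
  by rewrite memv_img // msf_B4.
have hE := symm_expansion (subvP (hit_B4 d) _ hH).
have coefE q : q \in parts d -> (val h)@_(mon q) =
    (odd (count_mem m [seq sort geq s | s <- sq_dual tbl q]))%:R.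
  by apply: mcoeff_Sq_msf => //; apply: ltnW.
have -> : msf d p =
    h - \sum_(q <- parts d | q != p) (val h)@_(mon q) *: msf d q.
  rewrite {1}hE (bigD1_seq p) ?bounded_parts_uniq //= addrK.
  by rewrite coefE // pE -row_odd // uo scale1r.
apply: rpredB; first exact: subvP HW _ hH.
rewrite big_seq_cond; apply: rpred_sum => q /andP[qP qp].
have [qU|qU] := boolP (q \in unzip1 U); last exact/rpredZ/UW.
have [v vU qE] := mapP qU; rewrite coefE // qE -row_odd //.
have [vo|] := boolP (odd_row v); last by rewrite scale0r rpred0.
by rewrite qE pE (unique u v) ?eqxx in qp.
Qed.

Lemma foldl_sq_eliminateP (W : {vspace P4 d}) ms U :
  (hit B4 d <= W)%VS -> {subset ms <= lower_parts d} ->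
  spanned_outside W U -> spanned_outside W (foldl sq_eliminate U ms).
Proof.
move=> HW; elim: ms U => //= m ms IHms U msP UW; apply: IHms => [s sms|].
  by apply: msP; rewrite inE sms orbT.
by apply: sq_eliminateP => //; apply: msP; rewrite mem_head.
Qed.

Lemma certificateP L G : certificate d L G ->
  (B4 d :&: hit P4full d)%VS = hit B4 d /\
  (\dim (hit B4 d) + size G = size (parts d))%N.
Proof.
case/and5P=> /eqP LG aL /allP GP /allP delta /nilP elim_nil.
pose W := (hit B4 d + <<[seq msf d g | g <- G]>>)%VS.
have BW : (B4 d <= W)%VS.
  have HW : (hit B4 d <= W)%VS by apply: addvSl.
  pose ms := flatten (nseq 3 (lower_parts d)).
  pose U := sq_rows tbl [seq p <- parts d | p \notin G].
  have msP : {subset ms <= lower_parts d}.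
    by move=> m /flattenP[s /nseqP[-> _]].
  have UW : spanned_outside W U.
    split=> [u /mapP[p]|p pP].
      by rewrite mem_filter => /andP[_ pP] ->; apply: map_f.
    rewrite /unzip1 -map_comp map_id mem_filter pP andbT negbK => pG.
    by apply: subvP (addvSr _ _) _ _; rewrite memv_span // map_f.
  have [_ allW] := foldl_sq_eliminateP HW msP UW.
  apply/subvP => f /symm_expansion->; rewrite big_seq rpred_sum // => p pP.
  (* No row is left, so the invariant covers every partition. *)
  by rewrite rpredZ // allW // elim_nil.
have dimB : (\dim (B4 d) <= \dim (hit B4 d) + size G)%N.
  rewrite (leq_trans (dimvS BW)) // (leq_trans (dimv_add_leqif _ _)) //.
  by rewrite leq_add2l (leq_trans (dim_span _)) // size_map.
have sizeL : all (all (fun e => size e == 4)) L.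
  apply/allP => S /(allP aL)/andP[/allP Sd _]; apply/allP => e /Sd.
  by case/andP.
have cap : \dim (B4 d) =
    (\dim (B4 d :&: lker (linfun (@eval_mons d L))) + size L)%N.
  apply: dim_cap_eval => i; have iG : (i < size G)%N by rewrite -LG.
  exists (msf d (nth [::] G i)).
    by rewrite msf_B4 // (size_mem_parts (GP _ (mem_nth _ iG))).
  apply/rowP => j; have jG : (j < size G)%N by rewrite -LG.
  rewrite eval_msf ?GP ?mem_nth // mxE eqxx /=.
  have /delta/allP : nat_of_ord j \in iota 0 (size G) by rewrite mem_iota.
  by move=> /(_ i); rewrite mem_iota => /(_ iG)/eqP->.
have HK : (hit B4 d <= B4 d :&: hit P4full d)%VS.
  by rewrite subv_cap hit_B4 hitS // => e; apply: subvf.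
have Kker := capvS (subvv (B4 d)) (hit_annihilating aL).
(* The functionals give codimension at least [size G] for the larger space, while [dimB] gives at
   most [size G] for the smaller one. *)
have dimK : (\dim (B4 d :&: hit P4full d) + size G <= \dim (B4 d))%N.
  by rewrite cap -LG leq_add2r dimvS.
have dimKH : (\dim (B4 d :&: hit P4full d) <= \dim (hit B4 d))%N.
  by rewrite -(leq_add2r (size G)) (leq_trans dimK).
split; first by apply/esym/eqP; rewrite eqEdim HK.
apply/eqP; rewrite -dim_B4 eqn_leq dimB andbT (leq_trans _ dimK) //.
by rewrite leq_add2r dimvS.
Qed.

Lemma certificate_dims L G : certificate d L G ->
  [/\ relcohit d = 0%VS, \dim (B4 d) = size (parts d),
      \dim (hit B4 d) = (size (parts d) - size G)%N,
      \dim (cohit B4 d) = size G &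
      forall f, f \in B4 d -> f \in hit P4full d -> f \in hit B4 d].
Proof.
case/certificateP=> capE dimH; split.
- apply/eqP; rewrite -dimv_eq0 relcohitE capE.
  by rewrite dim_subquot // subnn.
- exact: dim_B4.
- by rewrite -dimH addnK.
- by rewrite dim_subquot ?hit_B4 // dim_B4 -dimH addKn.
by move=> f fB fH; rewrite -capE memv_cap fB.
Qed.

End Elimination.

Theorem theorem1p4 :
  [/\ relcohit 8 = 0%VS, relcohit 12 = 0%VS,
      relcohit 14 = 0%VS & relcohit 22 = 0%VS] /\
  [/\ [/\ \dim (B4 8) = 15%N, \dim (hit B4 8) = 11%N,
          \dim (cohit B4 8) = 4%N & \dim (relcohit 8) = 0%N],
      [/\ \dim (B4 12) = 34%N, \dim (hit B4 12) = 32%N,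
          \dim (cohit B4 12) = 2%N & \dim (relcohit 12) = 0%N],
      [/\ \dim (B4 14) = 47%N, \dim (hit B4 14) = 43%N,
          \dim (cohit B4 14) = 4%N & \dim (relcohit 14) = 0%N] &
      [/\ \dim (B4 22) = 136%N, \dim (hit B4 22) = 129%N,
          \dim (cohit B4 22) = 7%N & \dim (relcohit 22) = 0%N]] /\
  (forall d : nat, d \in [:: 8; 12; 14; 22]%N ->
     forall f : P4 d, f \in B4 d -> f \in hit P4full d -> f \in hit B4 d).
Proof.
have [r8 b8 h8 c8 k8] := certificate_dims certificate8.
have [r12 b12 h12 c12 k12] := certificate_dims certificate12.
have [r14 b14 h14 c14 k14] := certificate_dims certificate14.
have [r22 b22 h22 c22 k22] := certificate_dims certificate22.
split=> //; split; last by move=> d; rewrite !inE => /or4P[]/eqP->.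
(* What remains are closed sizes such as [size (parts 22)], settled by computation. *)
by rewrite r8 r12 r14 r22 !dimv0 b8 h8 c8 b12 h12 c12 b14 h14 c14 b22 h22 c22.
Qed.
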